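(* If $H$ is a finite-dimensional Hopf quasigroup over a field $k$, then its antipode $S:H\to H$ is bijective.
   Context: Let $k$ be a field. A Hopf quasigroup over $k$ is a $k$-vector space $H$ with a unital, not necessarily associative, bilinear product, together with (unital) algebra homomorphisms $\Delta:H\to H\otimes H$ and $\varepsilon:H\to k$ forming a coassociative counital coalgebra, and a linear map $S:H\to H$ (the antipode) such that, in Sweedler notation $\Delta h=h_{(1)}\otimes h_{(2)}$ (summation omitted), for all $h,g\in H$: $S(h_{(1)})(h_{(2)}g)=h_{(1)}(S(h_{(2)})g)=(gS(h_{(1)}))h_{(2)}=(gh_{(1)})S(h_{(2)})=\varepsilon(h)g$. *)

(* Defs.v *)
From HB Require Import structures.
From mathcomp Require Import all_boot all_order all_algebra.

Set Implicit Arguments.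
Unset Strict Implicit.
Unset Printing Implicit Defensive.

Import GRing.Theory.

Local Open Scope ring_scope.

(** Tensor product of finite-dimensional spaces.  A tensor is stored as the
    matrix of its coordinates in the basis e_i (x) e_j; lemmas [tens_bilinear],
    [tliftE] and [tlift_unique] give its universal property, so the choice of
    bases is immaterial. *)

Definition tensor (k : fieldType) (U V : vectType k) : Type :=
  'M[k]_(\dim {:U}, \dim {:V}).

HB.instance Definition _ (k : fieldType) (U V : vectType k) :=
  Vector.copy (tensor U V) 'M[k]_(\dim {:U}, \dim {:V}).

Definition tens (k : fieldType) (U V : vectType k) (u : U) (v : V)
    : tensor U V :=
  \matrix_(i, j) (coord (vbasis {:U}) i u * coord (vbasis {:V}) j v).

Notation "u *t v" := (tens u v) (at level 40, left associativity) : ring_scope.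

Fact tens_bilinear (k : fieldType) (U V : vectType k) :
  bilinear_for *:%R *:%R (@tens k U V).
Proof.
by split=> [v a u u' | u a v v']; apply/matrixP=> i j;
  rewrite !mxE linearP ?mulrDl ?mulrDr !mulrA // (mulrC _ a).
Qed.

HB.instance Definition _ (k : fieldType) (U V : vectType k) :=
  bilinear_isBilinear.Build k U V (tensor U V) *:%R *:%R (@tens k U V)
    (@tens_bilinear k U V).

(** The linear map U (x) V -> W induced by a bilinear map f : U -> V -> W.  The
    definition only uses f on the bases; it is meant for bilinear f, where
    [tliftE] holds. *)
Definition tlift (k : fieldType) (U V : vectType k) (W : lmodType k)
    (f : U -> V -> W) (t : tensor U V) : W :=
  \sum_i \sum_j t i j *: f (vbasis {:U})`_i (vbasis {:V})`_j.

Fact tlift_linear (k : fieldType) (U V : vectType k) (W : lmodType k)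
    (f : U -> V -> W) :
  linear (tlift f).
Proof.
move=> a s t; rewrite /tlift scaler_sumr -big_split /=.
apply: eq_bigr => i _; rewrite scaler_sumr -big_split /=.
by apply: eq_bigr => j _; rewrite !mxE scalerDl scalerA.
Qed.

HB.instance Definition _ (k : fieldType) (U V : vectType k) (W : lmodType k)
    (f : U -> V -> W) :=
  GRing.isLinear.Build k (tensor U V) W *:%R (tlift f) (tlift_linear f).

Lemma tliftE (k : fieldType) (U V : vectType k) (W : lmodType k)
    (f : U -> V -> W) :
  bilinear_for *:%R *:%R f -> forall u v, tlift f (u *t v) = f u v.
Proof.
move=> [fl fr] u v.
pose B := bilinear_isBilinear.Build k U V W *:%R *:%R f (fl, fr).
pose F : {bilinear U -> V -> W} := HB.pack f B.
rewrite -[f]/(F : U -> V -> W) /tlift.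
rewrite {2}(coord_vbasis (memvf u)) {2}(coord_vbasis (memvf v)).
rewrite linear_sumlz; apply: eq_bigr => i _.
rewrite linear_sumr; apply: eq_bigr => j _.
by rewrite mxE linearZl_LR linearZr_LR scalerA.
Qed.

Lemma tens_decomp (k : fieldType) (U V : vectType k) (t : tensor U V) :
  t = \sum_i \sum_j t i j *: ((vbasis {:U})`_i *t (vbasis {:V})`_j).
Proof.
apply/matrixP=> p q; rewrite summxE (bigD1 p) //= summxE (bigD1 q) //= !mxE.
have fU := basis_free (vbasisP {:U}); have fV := basis_free (vbasisP {:V}).
rewrite !coord_free // !eqxx !mulr1 !big1 ?addr0 // => i /negPf ne.
  by rewrite summxE big1 // => j _; rewrite !mxE !coord_free // ne mul0r mulr0.
by rewrite !mxE !coord_free // ne !mulr0.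
Qed.

Lemma tlift_unique (k : fieldType) (U V : vectType k) (W : lmodType k)
    (f : U -> V -> W) (g : {linear tensor U V -> W}) :
  (forall u v, g (u *t v) = f u v) -> g =1 tlift f.
Proof.
move=> gE t; rewrite {1}(tens_decomp t) linear_sum; apply: eq_bigr => i _.
by rewrite linear_sum; apply: eq_bigr => j _; rewrite linearZ gE.
Qed.

Lemma tlift_linear_fun (k : fieldType) (U V : vectType k) (W : lmodType k)
    (a : k) (f g h : U -> V -> W) :
  (forall u v, h u v = a *: f u v + g u v) ->
  forall t, tlift h t = a *: tlift f t + tlift g t.
Proof.
move=> hE t; rewrite /tlift scaler_sumr -big_split /=.
apply: eq_bigr => i _; rewrite scaler_sumr -big_split /=.
by apply: eq_bigr => j _; rewrite hE scalerDr !scalerA mulrC.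
Qed.

Definition tmap (k : fieldType) (U V U' V' : vectType k)
    (f : U -> U') (g : V -> V') : tensor U V -> tensor U' V' :=
  tlift (fun u v => f u *t g v).

Lemma tmapE (k : fieldType) (U V U' V' : vectType k)
    (f : {linear U -> U'}) (g : {linear V -> V'}) u v :
  tmap f g (u *t v) = f u *t g v.
Proof.
by rewrite /tmap tliftE //; split=> z a x y;
  rewrite linearP ?linearPl ?linearPr.
Qed.

Definition tassoc (k : fieldType) (U V W : vectType k) :
    tensor (tensor U V) W -> tensor U (tensor V W) :=
  tlift (fun t w => tlift (fun u v => u *t (v *t w)) t).

Lemma tassocE (k : fieldType) (U V W : vectType k) (u : U) (v : V) (w : W) :
  tassoc ((u *t v) *t w) = u *t (v *t w).
Proof.
have bil w' : bilinear_for *:%R *:%R (fun (u : U) (v : V) => u *t (v *t w')).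
  by split=> z a x y; rewrite ?linearPl ?linearPr.
rewrite /tassoc tliftE ?tliftE //; split=> [z|t] a x y; first exact: linearP.
by apply: tlift_linear_fun => u' v'; rewrite !linearPr.
Qed.

Definition tmul (k : fieldType) (H : vectType k) (m : H -> H -> H)
    (s t : tensor H H) : tensor H H :=
  tlift (fun a b => tlift (fun c d => m a c *t m b d) t) s.

Lemma tmulE (k : fieldType) (H : vectType k) (m : {bilinear H -> H -> H})
    (a b c d : H) :
  tmul m (a *t b) (c *t d) = m a c *t m b d.
Proof.
have bil a' b' : bilinear_for *:%R *:%R (fun c d => m a' c *t m b' d).
  by split=> z e x y; rewrite linearPr ?linearPl ?linearPr.
rewrite /tmul tliftE ?tliftE //; split=> z e x y;
  by apply: tlift_linear_fun => u v; rewrite linearPl ?linearPl ?linearPr.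
Qed.

(** Each Sweedler expression F(h_(1), h_(2)), bilinear in its two arguments, is
    [tlift F (hq_comul h)]. *)
Record hopf_quasigroup (k : fieldType) (H : vectType k) := HopfQuasigroup {
  hq_mul : {bilinear H -> H -> H};
  hq_one : H;
  hq_comul : {linear H -> tensor H H};
  hq_counit : {scalar H};
  hq_antipode : {linear H -> H};
  hq_mul1l : forall h, hq_mul hq_one h = h;
  hq_mul1r : forall h, hq_mul h hq_one = h;
  hq_comulM : forall h g,
    hq_comul (hq_mul h g) = tmul hq_mul (hq_comul h) (hq_comul g);
  hq_comul1 : hq_comul hq_one = hq_one *t hq_one;
  hq_counitM : forall h g,
    hq_counit (hq_mul h g) = hq_counit h * hq_counit g;
  hq_counit1 : hq_counit hq_one = 1;
  hq_coassoc : forall h,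
    tassoc (tmap hq_comul id (hq_comul h)) = tmap id hq_comul (hq_comul h);
  hq_counitl : forall h, tlift (fun x y => hq_counit x *: y) (hq_comul h) = h;
  hq_counitr : forall h, tlift (fun x y => hq_counit y *: x) (hq_comul h) = h;
  hq_antipode_mulK : forall h g,
    tlift (fun x y => hq_mul (hq_antipode x) (hq_mul y g)) (hq_comul h)
      = hq_counit h *: g;
  hq_mul_antipodeK : forall h g,
    tlift (fun x y => hq_mul x (hq_mul (hq_antipode y) g)) (hq_comul h)
      = hq_counit h *: g;
  hq_mulK_antipode : forall h g,
    tlift (fun x y => hq_mul (hq_mul g (hq_antipode x)) y) (hq_comul h)
      = hq_counit h *: g;
  hq_mulK_mul : forall h g,
    tlift (fun x y => hq_mul (hq_mul g x) (hq_antipode y)) (hq_comul h)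
      = hq_counit h *: g
}.

(* Main.v *)
Require Import Defs.
From HB Require Import structures.
From mathcomp Require Import all_boot all_order all_algebra.

Set Implicit Arguments.
Unset Strict Implicit.
Unset Printing Implicit Defensive.

Import GRing.Theory.

Local Open Scope ring_scope.

(** The argument is the integral-theoretic one for finite-dimensional Hopf
    algebras, arranged so that associativity is never used.

    The dual space H^* is a right H-comodule, f |-> f_0 (x) f_1, where
    f_0(x) f_1 = x_(1) f(x_(2)), and H acts on it by (f . h)(x) = f(x S(h)).
    This need not be an action of an algebra, but the coaction still satisfies
    (f . h)_0 (x) (f . h)_1 = f_0 . h_(1) (x) f_1 h_(2)
    ([sw_functional_antipode]): this only needs that S reverses the coproduct
    ([sw_antipode]) and (g S(h_(1))) h_(2) = eps(h) g.  The companion axiom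
    (g l_(1)) S(l_(2)) = eps(l) g, for l = S(h), says that acting by S(h_(1))
    and then by h_(2) is acting by eps(h).  Hence the usual averaging
    P(f) = f_0 . S(f_1) ([integral_of]) has coinvariant values, that is, P(f) is
    an integral, x_(1) P(f)(x_(2)) = P(f)(x) 1 ([integral_ofP]), and f is
    recovered as f = P(f_0) . f_1 ([integral_of_recover]).

    Let S(h) = 0 and let f be an integral.  The coaction formula gives
    f(x S(h_(1))) h_(2) = x_(1) f(x_(2) S(h)) = 0 for all x; coacting once more
    on the second factor and cancelling S(h_(1)) on the left turns this into
    f(x) h = 0 ([antipode_kernel_integral]).  If h were nonzero, every integral
    would vanish, hence every functional by the recovery formula, and so would
    h itself.  Thus S is injective, and bijective since dim H is finite. *)

(** * Multilinear expressions *)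

Section LinearExpressions.

Variable k : fieldType.
Implicit Types U V W : lmodType k.

Lemma linear_id U : linear (fun x : U => x).
Proof. by []. Qed.

Lemma linear_app U V W (f : V -> W) (g : U -> V) :
  linear f -> linear g -> linear (fun x => f (g x)).
Proof. by move=> hf hg a x y; rewrite hg hf. Qed.

Lemma linear_map U V W (f : {linear V -> W}) (g : U -> V) :
  linear g -> linear (fun x => f (g x)).
Proof. by apply: linear_app; apply: linearP. Qed.

Lemma linear_mapl U V V' W (f : {bilinear V -> V' -> W}) (g : U -> V) c :
  linear g -> linear (fun x => f (g x) c).
Proof. by apply: (@linear_app _ _ _ (f^~ c)) => a x y; rewrite linearPl. Qed.

Lemma linear_mapr U V V' W (f : {bilinear V' -> V -> W}) (g : U -> V) c :
  linear g -> linear (fun x => f c (g x)).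
Proof. by apply: linear_app => a x y; rewrite linearPr. Qed.

(** Functionals take values in the regular module [k^o], so that they are linear
    maps of modules like all the others. *)
Lemma linear_scalel U W (f : U -> k^o) (v : W) :
  linear f -> linear (fun x => (f x : k) *: v).
Proof. by move=> hf a x y; rewrite hf scalerDl scalerA. Qed.

Lemma linear_scaler U W (c : k) (f : U -> W) :
  linear f -> linear (fun x => c *: f x).
Proof. by move=> hf a x y; rewrite hf scalerDr !scalerA mulrC. Qed.

Lemma linear_at0 U W (f : U -> W) : linear f -> f 0 = 0.
Proof.
by move=> hf; have := hf (-1) 0 0; rewrite scaler0 addr0 scaleN1r addNr.
Qed.

Lemma linear_sumf U W (I : Type) (r : seq I) (P : pred I) (f : I -> U -> W) :
  (forall i, linear (f i)) -> linear (fun x => \sum_(i <- r | P i) f i x).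
Proof.
move=> hf a x y; rewrite scaler_sumr -big_split /=.
by apply: eq_bigr => i _; apply: hf.
Qed.

Lemma linear_lift U (A B : vectType k) W (F : U -> A -> B -> W) t :
  (forall a b, linear (fun x => F x a b)) -> linear (fun x => tlift (F x) t).
Proof. by move=> hF a x y; apply: tlift_linear_fun => u v; apply: hF. Qed.

Lemma eq_tlift (A B : vectType k) W (F G : A -> B -> W) t :
  (forall a b, F a b = G a b) -> tlift F t = tlift G t.
Proof.
by move=> FG; apply: eq_bigr => i _; apply: eq_bigr => j _; rewrite FG.
Qed.

Lemma tlift_sum (A B : vectType k) W (I : Type) (r : seq I) (P : pred I)
    (F : I -> A -> B -> W) t :
  tlift (fun a b => \sum_(i <- r | P i) F i a b) t
  = \sum_(i <- r | P i) tlift (F i) t.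
Proof.
rewrite /tlift [RHS]exchange_big; apply: eq_bigr => p _ /=.
rewrite [RHS]exchange_big; apply: eq_bigr => q _ /=.
by rewrite scaler_sumr.
Qed.

Lemma linear_tlift (A B : vectType k) V W (L : V -> W) (F : A -> B -> V) t :
  linear L -> L (tlift F t) = tlift (fun a b => L (F a b)) t.
Proof.
move=> hL; pose B' := GRing.isLinear.Build k V W *:%R L hL.
pose L' : {linear V -> W} := HB.pack L B'.
rewrite -[L]/(L' : V -> W) linear_sum; apply: eq_bigr => i _.
by rewrite linear_sum; apply: eq_bigr => j _; rewrite linearZ.
Qed.

Lemma tliftZ (A B : vectType k) W c (F : A -> B -> W) t :
  tlift (fun a b => c *: F a b) t = c *: tlift F t.
Proof. by rewrite (@linear_tlift _ _ _ _ ( *:%R c)) //; apply: linear_scaler. Qed.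

Lemma tlift_exchange (A B A' B' : vectType k) W
    (F : A -> B -> A' -> B' -> W) s t :
  tlift (fun a b => tlift (fun c d => F a b c d) t) s
  = tlift (fun c d => tlift (fun a b => F a b c d) s) t.
Proof.
rewrite {2 3}/tlift tlift_sum; apply: eq_bigr => p _.
by rewrite tlift_sum; apply: eq_bigr => q _; rewrite tliftZ.
Qed.

(** Inserting dual bases: lets a variable occurring inside a Sweedler summation
    be replaced by basis vectors, and conversely evaluates a trace. *)
Lemma linear_basis (A : vectType k) W (L : A -> W) x :
  linear L ->
  \sum_i coord (vbasis {:A}) i x *: L (vbasis {:A})`_i = L x.
Proof.
move=> hL; pose B := GRing.isLinear.Build k A W *:%R L hL.
pose L' : {linear A -> W} := HB.pack L B.
rewrite -[L]/(L' : A -> W) {2}(coord_vbasis (memvf x)) linear_sum.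
by apply: eq_bigr => i _; rewrite linearZ.
Qed.

End LinearExpressions.

(** * Sweedler calculus *)

Section HopfQuasigroup.

Variables (k : fieldType) (H : vectType k) (Q : hopf_quasigroup H).

Local Notation one := (hq_one Q).
Local Notation Delta := (hq_comul Q).
Local Notation eps := (hq_counit Q).
Local Notation S := (hq_antipode Q).
Local Notation "x ** y" := (hq_mul Q x y)
  (at level 40, left associativity).
(* [\sw_(a, b <- h) E] reads: E with a = h_(1) and b = h_(2). *)
Local Notation "\sw_ ( a , b <- h ) E" := (tlift (fun a b => E) (Delta h))
  (at level 41, a name, b name, h at level 50, E at level 41, right associativity).

Local Notation e i := ((vbasis {:H})`_i).
Local Notation co := (coord (vbasis {:H})).

Implicit Types (W : lmodType k) (h x y z : H).

Lemma linear_sw (U : lmodType k) W (F : H -> H -> W) (g : U -> H) :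
  linear g -> linear (fun x : U => \sw_(a, b <- g x) F a b).
Proof. by move=> hg a x y; rewrite hg !linearP. Qed.

(* Peels the expression down to its variable; linearity of abstract functions
   is looked up among the hypotheses, whatever their number of parameters. *)
Ltac linear_step := first
  [ match goal with
    | H : _ |- _ => by apply: H
    end
  | match goal with |- forall _ : _, _ => move=> ? end
  | apply: linear_sw
  | apply: linear_id
  | apply: linear_mapl
  | apply: linear_mapr
  | apply: linear_map
  | apply: linear_scalel
  | apply: linear_scaler
  | apply: linear_lift
  | apply: linear_sumf
  | match goal with
    | H : context [GRing.linear_for _ _] |- _ => apply: (linear_app H)
    | H : context [GRing.linear_for _ _] |- _ => apply: (linear_app (H _))
    | H : context [GRing.linear_for _ _] |- _ => apply: (linear_app (H _ _))
    | H : context [GRing.linear_for _ _] |- _ => apply: (linear_app (H _ _ _))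
    end ].
Ltac linearity := repeat linear_step.

Lemma sw_coassoc W (F : H -> H -> H -> W) h :
  (forall b c, linear (fun a => F a b c)) ->
  (forall a c, linear (fun b => F a b c)) ->
  (forall a b, linear (fun c => F a b c)) ->
  \sw_(u, c <- h) \sw_(a, b <- u) F a b c
  = \sw_(a, v <- h) \sw_(b, c <- v) F a b c.
Proof.
move=> F1 F2 F3.
pose Phi := tlift (fun a t => tlift (F a) t).
have PhiE a t : Phi (a *t t) = tlift (F a) t.
  rewrite /Phi tliftE //; split=> [t'|a'].
    by linearity.
  exact: linearP.
have assocE t c :
    tassoc (t *t c) = tlift (fun a b => a *t (b *t c)) t :> tensor H _.
  rewrite /tassoc tliftE //; split=> [c'|t']; first exact: linearP.
  by linearity.
have PhiP : linear Phi by exact: linearP.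
have := congr1 Phi (hq_coassoc Q h).
have tassocP : linear (@tassoc k H H H) by exact: linearP.
rewrite /tmap (linear_tlift _ _ tassocP) !(linear_tlift _ _ PhiP).
under eq_tlift => u c do rewrite assocE (linear_tlift _ _ PhiP).
under eq_tlift => u c do under eq_tlift => a b do rewrite PhiE tliftE //.
by under [RHS]eq_tlift => u c do rewrite PhiE.
Qed.

Lemma sw_counitl W (F : H -> W) h :
  linear F -> \sw_(a, b <- h) eps a *: F b = F h.
Proof.
move=> hF; rewrite -[in RHS](hq_counitl Q h) (linear_tlift _ _ hF).
by apply: eq_tlift => a b; rewrite (scalable_linear hF).
Qed.

Lemma sw_counitr W (F : H -> W) h :
  linear F -> \sw_(a, b <- h) eps b *: F a = F h.
Proof.
move=> hF; rewrite -[in RHS](hq_counitr Q h) (linear_tlift _ _ hF).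
by apply: eq_tlift => a b; rewrite (scalable_linear hF).
Qed.

Lemma sw_mul W (F : H -> H -> W) x y :
  (forall b, linear (F^~ b)) -> (forall a, linear (F a)) ->
  \sw_(p, q <- x ** y) F p q
  = \sw_(a, b <- x) \sw_(c, d <- y) F (a ** c) (b ** d).
Proof.
move=> F1 F2; rewrite hq_comulM /tmul (linear_tlift _ _ (linearP (tlift F))).
apply: eq_tlift => a b; rewrite (linear_tlift _ _ (linearP (tlift F))).
by apply: eq_tlift => c d; apply: tliftE.
Qed.

Lemma sw_one W (F : H -> H -> W) :
  (forall b, linear (F^~ b)) -> (forall a, linear (F a)) ->
  \sw_(a, b <- one) F a b = F one one.
Proof. by move=> F1 F2; rewrite hq_comul1 tliftE. Qed.

Lemma sw_antipode1 h : \sw_(a, b <- h) (S a ** b) = eps h *: one.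
Proof.
rewrite -hq_antipode_mulK; apply: eq_tlift => a b.
by rewrite hq_mul1r.
Qed.

Lemma sw_mul_antipode1 h : \sw_(a, b <- h) (a ** S b) = eps h *: one.
Proof.
rewrite -hq_mul_antipodeK; apply: eq_tlift => a b.
by rewrite hq_mul1r.
Qed.

Lemma counit_antipode h : eps (S h) = eps h.
Proof.
have epsP : linear (eps : H -> k^o) by move=> a x y; rewrite linearP.
have := congr1 (eps : H -> k^o) (sw_antipode1 h).
rewrite (linear_tlift _ _ epsP) [RHS]linearZ /= hq_counit1 mulr1 => <-.
have epsSP : linear (fun x => eps (S x) : k^o) by linearity.
rewrite -(sw_counitr h epsSP); apply: (@eq_tlift _ _ _ k^o) => a b.
by rewrite hq_counitM mulrC.
Qed.

(** The antipode reverses the coproduct.  For the convolution product of maps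
    H -> H (x) H, both sides are inverses of Delta; in place of associativity,
    the proof uses that convolution by S(h_(2)) (x) S(h_(1)) undoes convolution
    by Delta on the right of any tensor u ([KM] below, with u = Delta (S h_(1))),
    where it is the axiom (g h_(1)) S(h_(2)) = eps(h) g, applied twice. *)
Lemma sw_antipode W (F : H -> H -> W) h :
  (forall b, linear (F^~ b)) -> (forall a, linear (F a)) ->
  \sw_(p, q <- S h) F p q = \sw_(a, b <- h) F (S b) (S a).
Proof.
move=> F1 F2.
pose K z b := \sw_(p, q <- z) \sw_(r, s <- b) F (p ** S s) (q ** S r).
have K1 b : linear (K^~ b) by rewrite /K; linearity.
have K2 z : linear (K z) by rewrite /K; linearity.
have KM u b : \sw_(c, d <- b) K (u ** c) d = eps b *: \sw_(p, q <- u) F p q.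
  rewrite -tliftZ.
  transitivity (\sw_(c, d <- b) \sw_(p, q <- u) \sw_(c1, c2 <- c)
    \sw_(r, s <- d) F ((p ** c1) ** S s) ((q ** c2) ** S r)).
    apply: eq_tlift => c d; rewrite /K sw_mul //; linearity.
  etransitivity; first exact: tlift_exchange.
  apply: eq_tlift => p q /=.
  rewrite sw_coassoc; try by linearity.
  transitivity (\sw_(c1, v <- b) \sw_(w, s <- v) \sw_(c2, r <- w)
    F ((p ** c1) ** S s) ((q ** c2) ** S r)).
    by apply: eq_tlift => c1 v; rewrite [RHS]sw_coassoc //; linearity.
  transitivity (\sw_(c1, v <- b) F ((p ** c1) ** S v) q).
    apply: eq_tlift => c1 v.
    rewrite -(sw_counitl (F := fun s => F ((p ** c1) ** S s) q)); last by linearity.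
    apply: eq_tlift => w s.
    rewrite -(linear_tlift _ _ (F2 _)) hq_mulK_mul.
    by rewrite (scalable_linear (F2 _)).
  rewrite -(linear_tlift _ _ (F1 _)) hq_mulK_mul.
  by rewrite (scalable_linear (F1 _)).
transitivity (\sw_(a, b <- h) eps b *: \sw_(p, q <- S a) F p q).
  by rewrite (sw_counitr (F := fun a => \sw_(p, q <- S a) F p q)) //; linearity.
under eq_tlift => a b do rewrite -KM.
rewrite -sw_coassoc; try by linearity.
transitivity (\sw_(x, b <- h) eps x *: K one b).
  apply: eq_tlift => x b.
  rewrite -(linear_tlift _ _ (K1 _)) sw_antipode1.
  by rewrite (scalable_linear (K1 _)).
rewrite (sw_counitl h (K2 one)) /K sw_one; try by linearity.
by apply: eq_tlift => a b; rewrite !hq_mul1l.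
Qed.

(** * Integrals *)

(** The coaction of H on H^* is compatible with (f . h)(x) = f(x S(h)):
    expanding the coproduct of x S(h_(1)) produces (x_(1) S(h_(2))) h_(3), which
    collapses to x_(1). *)
Lemma sw_functional_antipode (f : H -> k^o) x h :
  linear f ->
  \sw_(p, q <- x) (f (q ** S h) : k) *: p
  = \sw_(a, b <- h) \sw_(p, q <- x ** S a) (f q : k) *: (p ** b).
Proof.
move=> hf; transitivity (\sw_(a, b <- h) \sw_(p, q <- x) \sw_(c, d <- a)
    (f (q ** S c) : k) *: (p ** S d ** b)); last first.
  apply: eq_tlift => a b; rewrite sw_mul; try by linearity.
  by apply: eq_tlift => p q; rewrite [RHS]sw_antipode //; linearity.
etransitivity; last exact: tlift_exchange.
apply: eq_tlift => p q /=.
rewrite sw_coassoc; try by linearity.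
rewrite -(sw_counitr (F := fun c => (f (q ** S c) : k) *: p)); last by linearity.
apply: eq_tlift => a v.
by rewrite tliftZ hq_mulK_antipode !scalerA mulrC.
Qed.

(** Convolution product e^i * f of functionals, with e^i the dual basis, so that
    f_0 (x) f_1 = sum_i (e^i * f) (x) e_i is the coaction of H on f. *)
Definition functional_shift (f : H -> k^o) i z : k^o :=
  \sw_(a, b <- z) co i a *: f b.

(** The averaging f_0 . S(f_1), where (f . h)(x) = f(x S(h)). *)
Definition integral_of (f : H -> k^o) x : k^o :=
  \sum_i functional_shift f i (x ** S (S (e i))).

Lemma linear_functional_shift f i :
  linear f -> linear (functional_shift f i).
Proof. by rewrite /functional_shift => hf; linearity. Qed.

Lemma linear_integral_of f : linear f -> linear (integral_of f).
Proof. by rewrite /integral_of /functional_shift => hf; linearity. Qed.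


(** Summing over i turns the coproduct of e_i into that of the component of z
    paired with e^i.  There p = z_(1) meets S(z_(2)) and both cancel; what
    remains is e^j paired with z_(3), and f with z_(4). *)
Lemma sum_functional_shift f j z :
  linear f ->
  \sum_i \sw_(a, b <- e i) co j b *:
    (\sw_(p, q <- z) (functional_shift f i q : k) *: (p ** S a))
  = (functional_shift f j z : k) *: one.
Proof.
move=> hf.
transitivity (\sw_(p, q <- z) \sw_(r, s <- q) \sw_(a, b <- r)
    ((f s : k) *: (co j b *: (p ** S a)))).
  transitivity (\sum_i \sw_(p, q <- z) \sw_(r, s <- q)
      (f s : k) *: (co i r *: (\sw_(a, b <- e i) co j b *: (p ** S a)))).
    apply: eq_bigr => i _.
    transitivity (\sw_(a, b <- e i) \sw_(p, q <- z) \sw_(r, s <- q)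
      co j b *: ((f s : k) *: (co i r *: (p ** S a)))).
      apply: eq_tlift => a b; rewrite -tliftZ; apply: eq_tlift => p q.
      rewrite tliftZ; congr (_ *: _).
      rewrite (linear_tlift (L := fun c : k^o => (c : k) *: (p ** S a)));
        last by linearity.
      by apply: eq_tlift => r s; rewrite -[LHS]scalerA scalerA mulrC -scalerA.
    etransitivity; first exact: tlift_exchange.
    apply: eq_tlift => p q /=.
    etransitivity; first exact: tlift_exchange.
    apply: eq_tlift => r s /=; rewrite -!tliftZ; apply: eq_tlift => a b.
    by rewrite !scalerA -mulrA mulrC.
  rewrite -tlift_sum; apply: eq_tlift => p q.
  rewrite -tlift_sum; apply: eq_tlift => r s.
  rewrite -scaler_sumr tliftZ; congr (_ *: _).
  by apply: (linear_basis (L := fun r => \sw_(a, b <- r) co j b *: (p ** S a)));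
    linearity.
transitivity (\sw_(p, q <- z) \sw_(a, v <- q) \sw_(b, s <- v)
    ((f s : k) *: (co j b *: (p ** S a)))).
  by apply: eq_tlift => p q; rewrite sw_coassoc //; linearity.
rewrite -sw_coassoc; try by linearity.
have linG : linear (fun v => (functional_shift f j v : k) *: one).
  by rewrite /functional_shift; linearity.
rewrite -(sw_counitl z linG); apply: eq_tlift => u v.
etransitivity; first exact: tlift_exchange.
rewrite (linear_tlift (L := fun c : k^o => (c : k) *: one)); last by linearity.
rewrite -tliftZ; apply: eq_tlift => b s /=.
rewrite !tliftZ sw_mul_antipode1 !scalerA.
by congr (_ *: _); rewrite mulrC [f s * _]mulrC.
Qed.

(** In the notation of coactions, with rho the coaction of H on H^*:
    rho(f_0 . S(f_1)) = f_0 . S(f_3) (x) f_1 S(f_2) = f_0 . S(f_1) (x) 1. *)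
Lemma integral_ofP f x :
  linear f ->
  \sw_(p, q <- x) (integral_of f q : k) *: p = (integral_of f x : k) *: one.
Proof.
move=> hf; have hs i := linear_functional_shift i hf.
transitivity (\sum_i \sw_(p, q <- x)
   (functional_shift f i (q ** S (S (e i))) : k) *: p).
  rewrite -tlift_sum; apply: eq_tlift => p q.
  by rewrite -scaler_suml.
transitivity (\sum_i \sum_j \sw_(a, b <- e i) co j b *:
    (\sw_(p, q <- x ** S (S (e j))) (functional_shift f i q : k) *: (p ** S a))).
  apply: eq_bigr => i _; rewrite sw_functional_antipode // sw_antipode.
  - rewrite -tlift_sum; apply: eq_tlift => a b.
    by rewrite (linear_basis (L := fun b => \sw_(p, q <- x ** S (S b))
      (functional_shift f i q : k) *: (p ** S a))) //; linearity.
  - by linearity.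
  - by linearity.
rewrite exchange_big scaler_suml; apply: eq_bigr => j _.
exact: sum_functional_shift.
Qed.

(** From f(y S(h_(1))) h_(2) = 0 for all y, one may apply Delta to h_(2) and let
    y depend on the new factor: y = x S(S(h_(2))) then cancels S(h_(1)), because
    S(h) has coproduct S(h_(2)) (x) S(h_(1)). *)
Lemma antipode_kernel_integral (f : H -> k^o) h x :
  linear f ->
  (forall z, \sw_(p, q <- z) (f q : k) *: p = (f z : k) *: one) ->
  S h = 0 -> (f x : k) *: h = 0.
Proof.
move=> hf intf Sh0.
have vanish y : \sw_(a, b <- h) (f (y ** S a) : k) *: b = 0.
  transitivity (\sw_(p, q <- y) (f (q ** S h) : k) *: p).
    rewrite sw_functional_antipode //; apply: eq_tlift => a b.
    rewrite -[X in _ *: X](hq_mul1l Q) -linearZl_LR -intf.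
    rewrite (linear_tlift (L := fun p => p ** b)); last by linearity.
    by apply: eq_tlift => p q; rewrite linearZl_LR.
  rewrite Sh0; transitivity (\sw_(p, q <- y) ((0 : k) *: p)).
    apply: eq_tlift => p q; rewrite linear0r; congr (_ *: _).
    by rewrite (linear_at0 hf).
  by rewrite (tliftZ _ (fun p _ => p)) scale0r.
transitivity (\sw_(u, c <- h) \sw_(a, b <- u) (f (x ** S (S b) ** S a) : k) *: c).
  rewrite -[in LHS](sw_counitl (F := fun c => (f x : k) *: c) h); last by linearity.
  apply: eq_tlift => u c.
  rewrite -(linear_tlift (L := fun z => (f z : k) *: c)); last by linearity.
  rewrite -(sw_antipode (F := fun p q => x ** S p ** q)); try by linearity.
  rewrite hq_mulK_antipode counit_antipode.
  by rewrite (scalable_linear hf) scalerA.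
rewrite sw_coassoc; try by linearity.
(* Freezing S(S(b)) at a basis vector separates it from the coproduct of v, so
   that [vanish] applies with a constant y. *)
transitivity (\sum_(j < \dim {:H}) \sw_(a, v <- h) \sw_(b, c <- v)
    (f (x ** S (S (e j)) ** S a) : k) *: (co j b *: c)).
  rewrite -tlift_sum; apply: eq_tlift => a v.
  rewrite -tlift_sum; apply: eq_tlift => b c.
  rewrite -(linear_basis (L := fun b => (f (x ** S (S b) ** S a) : k) *: c));
    last by linearity.
  by apply: eq_bigr => j _; rewrite !scalerA mulrC.
apply: big1 => j _.
transitivity (\sw_(a, v <- h) (f (x ** S (S (e j)) ** S a) : k) *:
   (\sw_(b, c <- v) (co j b *: c))).
  by apply: eq_tlift => a v; rewrite tliftZ.
pose L v := \sw_(b, c <- v) co j b *: c.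
have hL : linear L by rewrite /L; linearity.
transitivity (L (\sw_(a, b <- h) (f (x ** S (S (e j)) ** S a) : k) *: b)).
  rewrite (linear_tlift _ _ hL).
  by apply: eq_tlift => a v; rewrite (scalable_linear hL).
by rewrite vanish (linear_at0 hL).
Qed.

(** The identity f = f_0 . S(f_1) . f_2, where acting by S(k_(1)) and then by
    k_(2) amounts to eps(k): (x S(k_(2))) S(S(k_(1))) = eps(k) x is the axiom
    (g l_(1)) S(l_(2)) = eps(l) g for l = S(k). *)
Lemma integral_of_recover f x :
  linear f ->
  \sum_(i < \dim {:H})
    integral_of (functional_shift f i) (x ** S (e i)) = f x.
Proof.
move=> hf; have hs i := linear_functional_shift i hf.
transitivity (\sum_(i < \dim {:H}) \sum_(j < \dim {:H}) \sum_(l < \dim {:H})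
   \sw_(a, b <- e l) (co j a : k) *: ((co i b : k) *:
       functional_shift f l (x ** S (e i) ** S (S (e j))))).
  apply: eq_bigr => i _; apply: eq_bigr => j _.
  set z := x ** _ ** _; rewrite {1}/functional_shift.
  transitivity (\sw_(a, v <- z) \sw_(b, s <- v)
      ((co j a : k) *: ((co i b : k) *: f s))).
    by apply: eq_tlift => a v; rewrite tliftZ.
  rewrite -sw_coassoc; try by linearity.
  (* The factors co j a and co i b come from the coproduct of u; expanding u in
     the basis makes them coefficients of the coproduct of e_l. *)
  transitivity (\sum_(l < \dim {:H}) \sw_(u, s <- z) \sw_(a, b <- e l)
      ((co l u : k) *: ((co j a : k) *: ((co i b : k) *: f s)))).
    rewrite -tlift_sum; apply: eq_tlift => u s.
    under eq_bigr => l _ do rewrite tliftZ.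
    by rewrite (linear_basis (L := fun u => \sw_(a, b <- u)
      ((co j a : k) *: ((co i b : k) *: f s)))) //; linearity.
  apply: eq_bigr => l _; etransitivity; first exact: tlift_exchange.
  apply: eq_tlift => a b /=; rewrite -!tliftZ; apply: eq_tlift => u s.
  by rewrite !scalerA -mulrA mulrC.
under eq_bigr => i _ do rewrite exchange_big.
rewrite exchange_big /=.
transitivity (\sum_(l < \dim {:H}) (eps (e l) : k) *: functional_shift f l x).
  apply: eq_bigr => l _.
  rewrite -(scalable_linear (hs l)) -counit_antipode -hq_mulK_mul sw_antipode;
    try by linearity.
  rewrite (linear_tlift _ _ (hs l)).
  under eq_bigr => i _ do rewrite -tlift_sum.
  rewrite -tlift_sum; apply: eq_tlift => a b.
  rewrite -(linear_basis b (L := fun b => functional_shift f l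
    (x ** S b ** S (S a)))); last by linearity.
  apply: eq_bigr => i _.
  rewrite -(linear_basis a (L := fun a => functional_shift f l
    (x ** S (e i) ** S (S a)))); last by linearity.
  rewrite scaler_sumr; apply: eq_bigr => j _.
  by rewrite !scalerA mulrC.
rewrite -(sw_counitl x hf) /functional_shift.
under eq_bigr => l _ do rewrite -tliftZ.
rewrite -tlift_sum; apply: eq_tlift => u s.
rewrite -(linear_basis u (L := fun u => (eps u : k) *: f s)); last by linearity.
by apply: eq_bigr => l _; rewrite !scalerA mulrC.
Qed.

Lemma antipode_ker h : S h = 0 -> h = 0.
Proof.
move=> Sh0; apply/eqP; apply: contraT => h_neq0.
have integral0 (f : H -> k^o) x : linear f -> integral_of f x = 0.
  move=> hf; have := antipode_kernel_integral x (linear_integral_of hf)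
    (fun z => integral_ofP z hf) Sh0.
  by move/eqP; rewrite scaler_eq0 (negPf h_neq0) orbF => /eqP.
have coord0 j : co j h = 0.
  have hc : linear (co j : H -> k^o) by move=> a x y; rewrite linearP.
  rewrite -(integral_of_recover h hc) big1 // => i _.
  by apply: integral0; apply: linear_functional_shift.
case/eqP: h_neq0; rewrite (coord_vbasis (memvf h)) big1 // => j _.
by rewrite coord0 scale0r.
Qed.

End HopfQuasigroup.

Theorem corollary3p6 (k : fieldType) (H : vectType k) (Q : hopf_quasigroup H) :
  bijective (hq_antipode Q).
Proof.
have S_inj : lker (linfun (hq_antipode Q)) == 0%VS.
  apply/lker0P => x y; rewrite !lfunE /= => eqS.
  apply/eqP; rewrite -subr_eq0; apply/eqP; apply: (antipode_ker (Q := Q)).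
  by rewrite linearB eqS subrr.
exists (linfun (hq_antipode Q))^-1%VF => x.
  by rewrite -[hq_antipode Q x]lfunE lker0_lfunK.
by rewrite -[hq_antipode Q _]lfunE lker0_lfunVK.
Qed.
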